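(* Let $\mathcal A$ be a commutative Fréchet algebra which is a BSE-algebra, whose underlying Fréchet space is a Schwartz space, and whose carrier space $\Delta(\mathcal A)$ is discrete. Let $I$ be an essential closed ideal of $\mathcal A$. If $I$ has a bounded $\Delta$-weak approximate identity, then $I$ is a BSE-algebra.
   Context: A Fréchet algebra is a complete metrizable (Hausdorff) topological algebra over $\mathbb C$ whose topology is generated by a countable increasing family of submultiplicative seminorms $(p_\ell)_{\ell\in\mathbb N}$. A Fréchet space is Schwartz if for every continuous seminorm $p$ there is a continuous seminorm $q\ge p$ such that $\{x:q(x)\le1\}$ is precompact with respect to $p$. For a commutative Fréchet algebra $\mathcal C$, $\mathcal C^*$ is its topological dual, and the carrier space $\Delta(\mathcal C)\subseteq\mathcal C^*$ is the set of all nonzero continuous multiplicative linear functionals $\mathcal C\to\mathbb C$, with the Gelfand topology (topology of pointwise convergence on $\mathcal C$). BSE-functions: for a bounded set $M\subseteq\mathcal C$ and $f\in\mathcal C^*$, put $P_M(f)=\sup_{a\in M}|f(a)|$. A bounded continuous function $\sigma:\Delta(\mathcal C)\to\mathbb C$ is a BSE-function if there exist a bounded set $M\subseteq\mathcal C$ and a real number $\beta_M>0$ such that for all $n$, all $c_1,\dots,c_n\in\mathbb C$ and all $\varphi_1,\dots,\varphi_n\in\Delta(\mathcal C)$, $\left|\sum_{i=1}^n c_i\sigma(\varphi_i)\right|\le\beta_M P_M\left(\sum_{i=1}^n c_i\varphi_i\right)$. The set of all BSE-functions is $C_{\mathrm{BSE}}(\Delta(\mathcal C))$. Multipliers: a linear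 operator $T:\mathcal C\to\mathcal C$ is a multiplier if $aT(b)=T(ab)$ for all $a,b\in\mathcal C$; $\mathrm M(\mathcal C)$ is the set of all multipliers. For $T\in\mathrm M(\mathcal C)$ there is a unique continuous function $\widehat T$ on $\Delta(\mathcal C)$ with $\varphi(T(a))=\widehat T(\varphi)\varphi(a)$ for all $a\in\mathcal C$, $\varphi\in\Delta(\mathcal C)$. Put $\widehat{\mathrm M(\mathcal C)}=\{\widehat T:T\in\mathrm M(\mathcal C)\}$. $\mathcal C$ is a BSE-algebra if $\widehat{\mathrm M(\mathcal C)}=C_{\mathrm{BSE}}(\Delta(\mathcal C))$. A bounded net $(e_\alpha)$ in $\mathcal C$ is a (bounded) $\Delta$-weak approximate identity for $\mathcal C$ if $\varphi(e_\alpha)\to1$ for every $\varphi\in\Delta(\mathcal C)$. A closed ideal $I$ of $\mathcal A$ is a Fréchet algebra with the seminorms $p_\ell|_I$. The ideal $I$ is essential if $I$ equals the closed linear span of $\{ax:a\in\mathcal A,\ x\in I\}$. *)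

(* Defs.v *)
From HB Require Import structures.
From mathcomp Require Import all_boot all_order all_algebra.
From mathcomp Require Import all_classical all_reals all_analysis.
From mathcomp Require Import complex.

Set Implicit Arguments.
Unset Strict Implicit.
Unset Printing Implicit Defensive.

Import Order.TTheory GRing.Theory Num.Theory.
Import numFieldNormedType.Exports.

Local Open Scope classical_set_scope.
Local Open Scope ring_scope.
Local Open Scope complex_scope.

(* The R-valued modulus; the norm `|z| of R[i] is (modulus z)%:C. *)
Notation modulus := (@ComplexField.Normc.normc _) (only parsing).

Definition seminorm (R : realType) (V : lmodType R[i]) (p : V -> R) : Prop :=
  (forall x y, p (x + y) <= p x + p y) /\
  (forall (c : R[i]) x, p (c *: x) = modulus c * p x).

(* mathcomp rings are unital, so the product is part of the data. The
   entourages of tvsType need not be translation invariant: describing them,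
   and not just the neighbourhoods, by the seminorms makes `cauchy` in
   fcomplete mean Cauchy for the seminorms. Continuity of the product follows
   from submultiplicativity, metrizability from the countability of the
   family. *)
HB.mixin Record isCommFrechetAlgebra (R : realType) A & Tvs R[i] A := {
  fmul : A -> A -> A;
  fseminorm : nat -> A -> R;
  fmulA : associative fmul;
  fmulC : commutative fmul;
  fmulDl : forall x y z, fmul (x + y) z = fmul x z + fmul y z;
  fmulZl : forall (c : R[i]) x y, fmul (c *: x) y = c *: fmul x y;
  fseminormP : forall l, seminorm (fseminorm l);
  fseminorm_le : forall l m x, (l <= m)%N -> fseminorm l x <= fseminorm m x;
  fseminormM : forall l x y,
    fseminorm l (fmul x y) <= fseminorm l x * fseminorm l y;
  fentourageP : forall U : set (A * A), entourage U <->
    exists l, exists2 e : R, 0 < e &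
      [set xy | fseminorm l (xy.1 - xy.2) < e] `<=` U;
  fhausdorff : hausdorff_space A;
  fcomplete : forall F : set_system A, ProperFilter F -> cauchy F ->
    exists x : A, F --> x
}.

#[short(type="commFrechetAlgType")]
HB.structure Definition CommFrechetAlgebra (R : realType) :=
  {A of Tvs R[i] A & isCommFrechetAlgebra R A}.

Record closedIdeal (R : realType) (A : commFrechetAlgType R) := ClosedIdeal {
  ideal_set :> set A;
  ideal0 : ideal_set 0;
  idealD : forall x y, ideal_set x -> ideal_set y -> ideal_set (x + y);
  idealZ : forall (c : R[i]) x, ideal_set x -> ideal_set (c *: x);
  idealM : forall a x, ideal_set x -> ideal_set (fmul a x);
  ideal_closed : closed ideal_set
}.

Definition ideal_algebra (R : realType) (A : commFrechetAlgType R)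
  (I : closedIdeal A) : Type := set_type I.

Section IdealAlgebra.
Variables (R : realType) (A : commFrechetAlgType R) (I : closedIdeal A).
Local Notation J := (ideal_algebra I).
Implicit Types x y z : J.

HB.instance Definition _ := SubChoice.copy J (set_type I).
HB.instance Definition _ := Uniform.copy J (set_type I).

Local Lemma ideal_submod : subsemimod_closed (mem (ideal_set I)).
Proof.
split; first split.
- by rewrite inE; exact: ideal0.
- by move=> x y; rewrite !inE; exact: idealD.
- by move=> c x; rewrite !inE; exact: idealZ.
Qed.

HB.instance Definition _ :=
  GRing.SubChoice_isSubLmodule.Build R[i] A _ J ideal_submod.

Definition ideal_val (x : J) : A := \val x.
Local Notation inj := ideal_val.

Local Lemma ideal_val_continuous : continuous inj.
Proof. exact: initial_continuous. Qed.

Local Lemma continuous_ideal_val (T : topologicalType) (f : T -> J) :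
  continuous (inj \o f) -> continuous f.
Proof. exact: continuous_comp_initial. Qed.

Local Lemma ideal_valD x y : inj (x + y) = inj x + inj y.
Proof. by []. Qed.

Local Lemma ideal_valB x y : inj (x - y) = inj x - inj y.
Proof. exact: raddfB. Qed.

Local Lemma ideal_valZ (c : R[i]) x : inj (c *: x) = c *: inj x.
Proof. by []. Qed.

Local Lemma ideal_val_inj : injective inj.
Proof. exact: val_inj. Qed.

Local Lemma ideal_valP x : ideal_set I (inj x).
Proof. exact: set_valP. Qed.

Local Lemma ideal_add_continuous : continuous (fun x : J * J => x.1 + x.2).
Proof.
apply: continuous_ideal_val => -[x y].
rewrite (_ : inj \o _ = (fun z : A * A => z.1 + z.2) \o
  (fun z : J * J => (inj z.1, inj z.2))); last first.
  by apply/funext => z /=; rewrite ideal_valD.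
apply: (@continuous_comp (J * J)%type (A * A)%type A); last first.
  exact: add_continuous.
apply: cvg_pair => /=.
  by apply: cvg_comp; [exact: cvg_fst|exact: ideal_val_continuous].
by apply: cvg_comp; [exact: cvg_snd|exact: ideal_val_continuous].
Qed.

Local Lemma ideal_scale_continuous : continuous (fun z : R[i]^o * J => z.1 *: z.2).
Proof.
apply: continuous_ideal_val => -[c x].
rewrite (_ : inj \o _ = (fun z : R[i]^o * A => z.1 *: z.2) \o
  (fun z : R[i]^o * J => (z.1, inj z.2))); last first.
  by apply/funext => z /=; rewrite ideal_valZ.
apply: (@continuous_comp (R[i]^o * J)%type (R[i]^o * A)%type A); last first.
  exact: scale_continuous.
apply: (@cvg_pair _ _ _ _ (nbhs (c : R[i]^o)) (nbhs (inj x))) => /=.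
  exact: cvg_fst.
by apply: cvg_comp; [exact: cvg_snd|exact: ideal_val_continuous].
Qed.

Local Lemma ideal_locally_convex :
  exists2 B : set_system J, (forall b, b \in B -> convex_set b) & basis B.
Proof.
have [B Bconv [Bo Bb]] := @locally_convex R[i] A.
exists [set inj @^-1` b | b in B].
  move=> _ /[!inE] -[b Bb' <-] x y l; rewrite !inE /= => xb yb.
  have := Bconv b (mem_set Bb') _ _ l (mem_set xb) (mem_set yb).
  by rewrite inE /= /conv /= !(ideal_valD, ideal_valZ).
split.
  by move=> _ [b /Bo ob <-]; apply: open_comp => // z _; exact: ideal_val_continuous.
move=> x U [_ [[V oV <-]] Vx VU].
have [b [Bb1 bx] bV] := Bb (inj x) V (open_nbhs_nbhs (conj oV Vx)).
exists (inj @^-1` b); first by split => //; exists b.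
by move=> y /bV yV; exact: VU.
Qed.

HB.instance Definition _ :=
  PreTopologicalNmodule_isTopologicalNmodule.Build J ideal_add_continuous.
HB.instance Definition _ :=
  TopologicalNmodule_isTopologicalLmodule.Build R[i] J ideal_scale_continuous.
HB.instance Definition _ := Uniform_isTvs.Build R[i] J ideal_locally_convex.

Local Lemma mul_in x y : fmul (inj x) (inj y) \in ideal_set I.
Proof. by rewrite inE; apply: idealM; exact: ideal_valP. Qed.

Definition ideal_mul x y : J := exist _ (fmul (inj x) (inj y)) (mul_in x y).

Definition ideal_seminorm l x : R := fseminorm l (inj x).

Local Lemma ideal_valM x y : inj (ideal_mul x y) = fmul (inj x) (inj y).
Proof. by []. Qed.

Local Lemma ideal_mulA : associative ideal_mul.
Proof. by move=> x y z; apply: ideal_val_inj; rewrite !ideal_valM fmulA. Qed.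

Local Lemma ideal_mulC : commutative ideal_mul.
Proof. by move=> x y; apply: ideal_val_inj; rewrite !ideal_valM fmulC. Qed.

Local Lemma ideal_mulDl x y z :
  ideal_mul (x + y) z = ideal_mul x z + ideal_mul y z.
Proof. by apply: ideal_val_inj; rewrite ideal_valD !ideal_valM ideal_valD fmulDl. Qed.

Local Lemma ideal_mulZl (c : R[i]) x y :
  ideal_mul (c *: x) y = c *: ideal_mul x y.
Proof. by apply: ideal_val_inj; rewrite ideal_valZ !ideal_valM ideal_valZ fmulZl. Qed.

Local Lemma ideal_seminormP l : seminorm (ideal_seminorm l).
Proof.
have [pD pZ] := @fseminormP R A l.
by split=> [x y|c x]; rewrite /ideal_seminorm ?ideal_valD ?ideal_valZ ?pZ.
Qed.

Local Lemma ideal_seminorm_le l m x :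
  (l <= m)%N -> ideal_seminorm l x <= ideal_seminorm m x.
Proof. exact: fseminorm_le. Qed.

Local Lemma ideal_seminormM l x y :
  ideal_seminorm l (ideal_mul x y) <= ideal_seminorm l x * ideal_seminorm l y.
Proof. by rewrite /ideal_seminorm ideal_valM; exact: fseminormM. Qed.

Local Lemma ideal_entourageP (U : set (J * J)) : entourage U <->
  exists l, exists2 e : R, 0 < e &
    [set xy | ideal_seminorm l (xy.1 - xy.2) < e] `<=` U.
Proof.
split=> [[V /fentourageP[l [e e0 eV]] VU]|[l [e e0 eU]]].
  exists l, e => // -[x y]; rewrite /= /ideal_seminorm ideal_valB => xye.
  by apply: VU; exact: eV.
exists [set xy | fseminorm l (xy.1 - xy.2) < e].
  by apply/fentourageP; exists l, e.
by move=> xy /= xye; apply: eU; rewrite /= /ideal_seminorm ideal_valB.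
Qed.

Local Lemma ideal_hausdorff : hausdorff_space J.
Proof.
move=> x y xy; apply: ideal_val_inj; apply: (@fhausdorff R A) => U V Ux Vy.
have [z [Uz Vz]] := xy _ _ (ideal_val_continuous Ux) (ideal_val_continuous Vy).
by exists (inj z).
Qed.

Local Lemma ideal_complete (F : set_system J) : ProperFilter F -> cauchy F ->
  exists x : J, F --> x.
Proof.
move=> FF cF.
have [|a Fa] := @fcomplete R A (inj @ F) _.
  move=> U entU.
  have /cF[[P Q] [FP FQ] PQU] :
      entourage ((fun xy : J * J => (inj xy.1, inj xy.2)) @^-1` U).
    by exists U.
  exists (inj @` P, inj @` Q).
    by split; [apply: filterS FP|apply: filterS FQ] => z ?; exists z.
  by move=> [_ _] [/= [x Px <-] [y Qy <-]]; exact: (PQU (x, y)).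
have Ia : ideal_set I a.
  apply: (@ideal_closed _ _ I) => U /Fa FU.
  have /filter_ex[x Ux] : F (inj @^-1` U) by [].
  by exists (inj x); split => //; exact: ideal_valP.
exists (exist _ a (mem_set Ia)) => U [_ [[V oV <-]] Va VU].
have FV : F (inj @^-1` V) by apply: Fa; exact: open_nbhs_nbhs.
by apply: (@filterS _ F _ _ _ _ FV) => z; exact: VU.
Qed.

HB.instance Definition _ := isCommFrechetAlgebra.Build R J
  ideal_mulA ideal_mulC ideal_mulDl ideal_mulZl ideal_seminormP
  ideal_seminorm_le ideal_seminormM ideal_entourageP ideal_hausdorff
  ideal_complete.

End IdealAlgebra.

Section BSE.
Variables (R : realType) (A : commFrechetAlgType R).
(* The library puts the topology of a field on its regular module. *)
Local Notation C := R[i]^o.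

Definition frechet_bounded (M : set A) : Prop :=
  forall l, exists B : R, forall x, M x -> fseminorm l x <= B.

Definition precompact_wrt (p : A -> R) (S : set A) : Prop :=
  forall e : R, 0 < e -> exists2 F : set A, finite_set F &
    forall x, S x -> exists2 y, F y & p (x - y) < e.

Definition schwartz_space : Prop :=
  forall p : A -> R, seminorm p -> continuous p ->
  exists q : A -> R, [/\ seminorm q, continuous q, forall x, p x <= q x &
    precompact_wrt p [set x | q x <= 1]].

Definition topological_dual : set (A -> C) :=
  [set f : A -> C | linear f /\ continuous f].

Definition carrier_set : set {ptws A -> C} :=
  [set f : A -> C | [/\ topological_dual f, (forall a b, f (fmul a b) = f a * f b) &
    exists a, f a != 0]].

(* The topology on carrier_space is the subspace topology of {ptws A -> C}. *)
Definition carrier_space : Type := set_type carrier_set.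
HB.instance Definition _ :=
  Topological.copy carrier_space (set_type carrier_set).

Definition char_eval (phi : carrier_space) : A -> C := \val phi.
Coercion char_eval : carrier_space >-> Funclass.

(* For M empty, the supremum is sup set0 = 0. *)
Definition sup_on (M : set A) (f : A -> C) : R :=
  sup [set modulus (f a) | a in M].

Definition BSE_function (sigma : carrier_space -> C) : Prop :=
  [/\ bounded_fun sigma, continuous sigma &
    exists2 M : set A, frechet_bounded M &
    exists2 beta : R, 0 < beta &
    forall n (c : 'I_n -> C) (phi : 'I_n -> carrier_space),
      modulus (\sum_(i < n) c i * sigma (phi i)) <=
      beta * sup_on M (fun a => \sum_(i < n) c i * phi i a)].

Definition multiplier (T : A -> A) : Prop :=
  linear T /\ forall a b, fmul a (T b) = T (fmul a b).

Definition is_multiplier_transform (T : A -> A)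
    (sigma : carrier_space -> C) : Prop :=
  continuous sigma /\
  forall a (phi : carrier_space), phi (T a) = sigma phi * phi a.

Definition multiplier_transforms : set (carrier_space -> C) :=
  [set sigma | exists2 T, multiplier T & is_multiplier_transform T sigma].

Definition C_BSE : set (carrier_space -> C) :=
  [set sigma | BSE_function sigma].

Definition BSE_algebra : Prop := multiplier_transforms = C_BSE.

Definition directed (D : Type) (le : D -> D -> Prop) : Prop :=
  [/\ inhabited D, forall d, le d d,
    forall d1 d2 d3, le d1 d2 -> le d2 d3 -> le d1 d3 &
    forall d1 d2, exists2 d3, le d1 d3 & le d2 d3].

Definition tails (D : Type) (le : D -> D -> Prop) : set_system D :=
  filter_from setT (fun d => [set d' | le d d']).

Definition has_bounded_Delta_weak_approximate_identity : Prop :=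
  exists (D : Type) (le : D -> D -> Prop) (e : D -> A),
    [/\ directed le, frechet_bounded (range e) &
      forall phi : carrier_space, phi (e d) @[d --> tails le] --> (1 : C)].

Definition linear_span (S : set A) : set A :=
  [set x | exists n (c : 'I_n -> R[i]) (s : 'I_n -> A),
    (forall i, S (s i)) /\ x = \sum_(i < n) c i *: s i].

Definition essential_ideal (I : closedIdeal A) : Prop :=
  ideal_set I = closure
    (linear_span [set y | exists a x, ideal_set I x /\ y = fmul a x]).

End BSE.

Definition discrete_space (T : topologicalType) : Prop :=
  forall U : set T, open U.

(* Main.v *)
(* In a Frechet-Schwartz algebra bounded sets are relatively compact, so the
   bounded Delta-weak approximate identity of I has a cluster point u in I, and
   phi u = 1 for every character phi of I. Hence phi extends to the character
   a |-> phi (a u) of A.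
   - If T is a multiplier of I, its transform is phi |-> phi (T u), and a single
     element T u bounds it in the BSE inequality; it is a bounded function
     because A is BSE, so that the Gelfand transform of T u is bounded.
   - If sigma is a BSE-function on the carrier space of I, its extension by zero
     to the (discrete) carrier space of A is a BSE-function, hence the transform
     of a multiplier S of A, and x |-> (S u) x is a multiplier of I whose
     transform is sigma. No continuity of S is involved. *)
Require Import Defs.
From HB Require Import structures.
From mathcomp Require Import all_boot all_order all_algebra finmap.
From mathcomp Require Import all_classical all_reals all_analysis.
From mathcomp Require Import complex.

Set Implicit Arguments.
Unset Strict Implicit.
Unset Printing Implicit Defensive.

Import Order.TTheory GRing.Theory Num.Theory.
Import numFieldNormedType.Exports.

Local Open Scope classical_set_scope.
Local Open Scope ring_scope.
Local Open Scope complex_scope.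

Local Notation modulus := (@ComplexField.Normc.normc _) (only parsing).

(** * Seminorms and the topology that they generate *)

Lemma modulus_real (R : realType) (k : R) : modulus k%:C = `|k|.
Proof. by rewrite /= expr0n addr0 sqrtr_sqr. Qed.

Lemma seminorm0 (R : realType) (V : lmodType R[i]) (p : V -> R) :
  seminorm p -> p 0 = 0.
Proof. by move=> [_ pZ]; rewrite -(scale0r 0) pZ ComplexField.Normc.normc0 mul0r. Qed.

Lemma seminormN (R : realType) (V : lmodType R[i]) (p : V -> R) x :
  seminorm p -> p (- x) = p x.
Proof.
move=> [_ pZ]; rewrite -scaleN1r pZ.
by rewrite -(rmorphN1 (real_complex R)) modulus_real normrN1 mul1r.
Qed.

Lemma seminorm_ge0 (R : realType) (V : lmodType R[i]) (p : V -> R) x :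
  seminorm p -> 0 <= p x.
Proof.
move=> ps; have := ps.1 x (- x).
by rewrite subrr (seminorm0 ps) (seminormN _ ps) -mulr2n pmulrn_lge0.
Qed.

Lemma nbhs_fseminorm (R : realType) (A : commFrechetAlgType R) (x : A)
    (U : set A) : nbhs x U <->
  exists l, exists2 e : R, 0 < e & [set y | fseminorm l (x - y) < e] `<=` U.
Proof.
rewrite -nbhs_entourageE; split.
  move=> [V /fentourageP[l [e e0 eV]] VU]; exists l, e => // y xy.
  by apply: VU; rewrite /xsection /= inE; exact: eV.
move=> [l [e e0 eU]].
exists [set xy : A * A | fseminorm l (xy.1 - xy.2) < e].
  by apply/fentourageP; exists l, e.
by move=> y; rewrite /xsection /= inE; exact: eU.
Qed.

Lemma fseminorm_continuous (R : realType) (A : commFrechetAlgType R) l :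
  continuous (@fseminorm R A l).
Proof.
have ps := @fseminormP R A l.
move=> x; apply/cvgrPdist_lt => e e0.
apply/nbhs_fseminorm; exists l, e => // y /= xye.
apply: le_lt_trans xye; rewrite ler_norml lerBlDr lerNl opprB lerBlDr.
apply/andP; split; first by have := ps.1 (y - x) x; rewrite subrK -opprB seminormN.
by have := ps.1 (x - y) y; rewrite subrK.
Qed.

Lemma fmul_continuous (R : realType) (A : commFrechetAlgType R) (u : A) :
  continuous (fun a : A => fmul a u).
Proof.
move=> x U /nbhs_fseminorm[l [e e0 eU]]; apply/nbhs_fseminorm.
have c0 : 0 < fseminorm l u + 1.
  by rewrite ltr_wpDl// (seminorm_ge0 _ (fseminormP l)).
exists l, (e / (fseminorm l u + 1)); first by rewrite divr_gt0.
move=> y /=; rewrite ltr_pdivlMr// => xye; apply: eU => /=.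
have -> : fmul x u - fmul y u = fmul (x - y) u.
  by rewrite fmulDl -[- y]scaleN1r fmulZl scaleN1r.
apply: le_lt_trans (fseminormM _ _ _) _; apply: le_lt_trans xye.
by rewrite ler_wpM2l ?(seminorm_ge0 _ (fseminormP l))// lerDl.
Qed.

Lemma seminorm_le_fseminorm (R : realType) (A : commFrechetAlgType R)
    (q : A -> R) : seminorm q -> continuous q ->
  exists l, exists2 d : R, 0 < d & forall x, fseminorm l x < d -> q x < 1.
Proof.
move=> qs /(_ 0); rewrite /continuous_at (seminorm0 qs).
move=> /cvgrPdist_lt/(_ 1 ltr01)/nbhs_fseminorm[l [d d0 dq]].
exists l, d => // x xd; have /dq : fseminorm l (0 - x) < d.
  by rewrite sub0r (seminormN _ (fseminormP l)).
by rewrite /= sub0r normrN ger0_norm// (seminorm_ge0 _ qs).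
Qed.

(** Boundedness is defined by the [fseminorm l] alone. Scaling [M] into a ball of one of them on
    which [q < 1] carries it over to the seminorm that the Schwartz property supplies. *)
Lemma frechet_bounded_seminorm (R : realType) (A : commFrechetAlgType R)
    (q : A -> R) (M : set A) : seminorm q -> continuous q ->
  frechet_bounded M -> exists2 K : R, 0 < K & forall x, M x -> q x <= K.
Proof.
move=> qs qc bM.
have [l [d d0 dq]] := seminorm_le_fseminorm qs qc; have [B MB] := bM l.
(* [B] may be [0], or negative when [M] is empty. *)
have B0 : 0 < `|B| + 1 by rewrite ltr_wpDl.
set k := d / (`|B| + 1); have k0 : 0 < k by rewrite divr_gt0.
exists k^-1 => [|x /MB xB]; first by rewrite invr_gt0.
have /dq : fseminorm l (k%:C *: x) < d.
  rewrite (fseminormP l).2 modulus_real gtr0_norm// mulrAC ltr_pdivrMr//.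
  by rewrite ltr_pM2l// (le_lt_trans xB)// (le_lt_trans (ler_norm B))// ltrDl.
rewrite qs.2 modulus_real gtr0_norm// => /ltW.
by rewrite -[k^-1]mul1r ler_pdivlMr// mulrC.
Qed.

(** * Precompactness and convergence of ultrafilters *)

(** [K^-1 M] lies in the unit ball of [q]; a finite [e / K]-net of that ball, multiplied by [K], is
    an [e]-net of [M]. *)
Lemma schwartz_bounded_precompact (R : realType) (A : commFrechetAlgType R)
    (M : set A) l :
  schwartz_space A -> frechet_bounded M -> precompact_wrt (@fseminorm R A l) M.
Proof.
move=> /(_ _ (fseminormP l) (@fseminorm_continuous R A l))[q [qs qc _ pc]].
move=> /(frechet_bounded_seminorm qs qc)[K K0 MK] e e0.
have [|F finF FM] := pc (e / K); first by rewrite divr_gt0.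
exists [set K%:C *: y | y in F]; first exact: finite_image.
move=> x /MK xK; have [|y Fy xy] := FM (K^-1%:C *: x).
  rewrite /= qs.2 modulus_real gtr0_norm ?invr_gt0//.
  by rewrite mulrC ler_pdivrMr// mul1r.
exists (K%:C *: y); first by exists y.
have -> : x - K%:C *: y = K%:C *: (K^-1%:C *: x - y).
  rewrite scalerBr scalerA -rmorphM/= divff ?gt_eqF// rmorph1.
  by rewrite scale1r.
by rewrite (fseminormP l).2 modulus_real gtr0_norm// mulrC -ltr_pdivlMr.
Qed.

(** If no [U i] were in [G], all the complements would be, hence also their finite intersection with
    [M], which is empty. *)
Lemma ultra_finite_cover (T : Type) (I : choiceType) (G : set_system T)
    (F : set I) (U : I -> set T) (M : set T) : UltraFilter G -> G M ->
  finite_set F -> M `<=` \bigcup_(i in F) U i -> exists2 i, F i & G (U i).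
Proof.
move=> GU GM /finite_fsetP[X ->] MU; apply: contrapT => noU.
have GC : G (\bigcap_(i in [set` X]) ~` U i).
  apply: filter_bigI => i iX; have [GUi|//] := in_ultra_setVsetC (U i) GU.
  by exfalso; apply: noU; exists i.
have [x [Mx Cx]] := filter_ex (filterI GM GC).
by have [i iX Uix] := MU x Mx; exact: Cx iX Uix.
Qed.

(** Precompactness, taken in [A], makes [G] Cauchy: a ball of each finite cover of [M] belongs to
    [G]. Completeness of [I] gives the limit. *)
Lemma schwartz_ideal_bounded_cvg (R : realType) (A : commFrechetAlgType R)
    (I : closedIdeal A) (G : set_system (ideal_algebra I))
    (M : set (ideal_algebra I)) :
  schwartz_space A -> UltraFilter G -> G M -> frechet_bounded M ->
  exists x : ideal_algebra I, G --> x.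
Proof.
move=> schwA GU GM bM; apply: fcomplete => U /fentourageP[l [e e0 eU]].
have bM' : frechet_bounded (@ideal_val _ _ I @` M).
  by move=> m; have [B MB] := bM m; exists B => _ [x /MB xB <-].
have e20 : 0 < e / 2 by rewrite divr_gt0.
have [F finF MF] := schwartz_bounded_precompact l schwA bM' e20.
(* The centres of the covering balls may lie outside of the ideal. *)
pose V y := [set x : ideal_algebra I | fseminorm l (ideal_val x - y) < e / 2].
have MV : M `<=` \bigcup_(y in F) V y.
  by move=> x Mx; have [|y] := MF (ideal_val x); [exists x|exists y].
have [y Fy GV] := ultra_finite_cover GU GM finF MV.
exists (V y, V y) => // -[a b] [/= Va Vb]; apply: eU => /=.
have -> : fseminorm l (a - b) =
    fseminorm l ((ideal_val a - y) - (ideal_val b - y)).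
  by rewrite opprB addrA subrK -raddfB.
rewrite (splitr e); apply: le_lt_trans (ltrD Va Vb).
rewrite -[leRHS]/(_ + _) -(seminormN (ideal_val b - y) (fseminormP l)).
exact: (fseminormP l).1.
Qed.

(** * An element on which every character of the ideal is one *)

Lemma tails_proper_filter (D : Type) (le : D -> D -> Prop) :
  directed le -> ProperFilter (tails le).
Proof.
move=> [[d0] lexx letr dir]; apply: filter_from_proper.
  apply: filter_from_filter; first by exists d0.
  move=> i j _ _; have [k ik jk] := dir i j; exists k => // d kd.
  by split; [exact: letr kd|exact: letr kd].
by move=> d _; exists d; exact: lexx.
Qed.

Definition mk_char (R : realType) (A : commFrechetAlgType R) (f : A -> R[i]^o)
    (h : carrier_set f) : carrier_space A :=
  exist (fun g => g \in @carrier_set R A) f (mem_set h).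

Lemma charP (R : realType) (A : commFrechetAlgType R) (phi : carrier_space A) :
  carrier_set (phi : A -> R[i]^o).
Proof. exact: set_valP. Qed.

Lemma charM (R : realType) (A : commFrechetAlgType R) (phi : carrier_space A) a b :
  phi (fmul a b) = phi a * phi b.
Proof. by have [_ ->] := charP phi. Qed.

Lemma schwartz_ideal_char_unit (R : realType) (A : commFrechetAlgType R)
    (I : closedIdeal A) : schwartz_space A ->
  has_bounded_Delta_weak_approximate_identity (ideal_algebra I) ->
  exists u : ideal_algebra I, forall phi : carrier_space (ideal_algebra I),
    phi u = 1.
Proof.
move=> schwA [D [le [e [dle be e1]]]].
have FF := tails_proper_filter dle.
(* An ultrafilter finer than the net stands for a convergent subnet. It is chosen before [phi], so
   one limit [u] serves all characters. *)
have [G [GU eG]] := ultraFilterLemma (fmap_proper_filter e FF).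
have [|u Gu] := schwartz_ideal_bounded_cvg schwA GU _ be.
  by apply: eG; apply: (@filterE _ (tails le)) => d; exists d.
exists u => phi.
have [[_ phic] _ _] := charP phi.
apply: (@cvg_unique R[i]^o _ (phi @ G)); first exact: norm_hausdorff.
  exact: cvg_comp (Gu) (phic u).
by move=> U /(e1 phi) UF; exact: eG.
Qed.

(** * Multipliers and the action of the algebra on the ideal *)

Lemma multiplier_fmul (R : realType) (A : commFrechetAlgType R) (b : A) :
  multiplier (fmul b).
Proof.
split=> [c x y|a x]; last by rewrite !fmulA (fmulC a b).
by rewrite fmulC fmulDl fmulZl !(fmulC _ b).
Qed.

(** The Gelfand transform of [a] is the transform of the multiplier [fmul a]. *)
Lemma Gelfand_transform_BSE (R : realType) (A : commFrechetAlgType R) (a : A) :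
  BSE_algebra A -> discrete_space (carrier_space A) ->
  BSE_function (fun psi : carrier_space A => psi a).
Proof.
move=> AB disc; have : @C_BSE _ A (fun psi : carrier_space A => psi a); last by [].
rewrite -AB; exists (fmul a); first exact: multiplier_fmul.
split=> [|b psi]; last exact: charM.
by apply/continuousP => U _; exact: disc.
Qed.

Definition ideal_act (R : realType) (A : commFrechetAlgType R)
    (I : closedIdeal A) (a : A) (x : ideal_algebra I) : ideal_algebra I :=
  exist _ (fmul a (ideal_val x)) (mem_set (idealM a (set_valP x))).

Lemma ideal_act_linear (R : realType) (A : commFrechetAlgType R)
    (I : closedIdeal A) (a : A) : linear (@ideal_act R A I a).
Proof.
by move=> c x y; apply: val_inj => /=; have [+ _] := multiplier_fmul a; apply.
Qed.

Lemma ideal_actM (R : realType) (A : commFrechetAlgType R)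
    (I : closedIdeal A) (a : A) (x y : ideal_algebra I) :
  fmul x (ideal_act a y) = ideal_act a (fmul x y).
Proof. by apply: val_inj => /=; have [_] := multiplier_fmul a; apply. Qed.

Lemma ideal_act_continuous (R : realType) (A : commFrechetAlgType R)
    (I : closedIdeal A) (x : ideal_algebra I) :
  continuous (fun a : A => ideal_act a x).
Proof. by apply: continuous_comp_initial; exact: fmul_continuous. Qed.

(** Both sides equal [phi (ideal_act a (fmul u x))], since [a] moves freely across products in
    [I]. *)
Lemma char_ideal_act (R : realType) (A : commFrechetAlgType R)
    (I : closedIdeal A) (phi : carrier_space (ideal_algebra I)) u a x :
  phi u = 1 -> phi (ideal_act a x) = phi (ideal_act a u) * phi x.
Proof.
move=> phiu; rewrite -[LHS]mul1r -phiu -!charM ideal_actM.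
by rewrite [in RHS]fmulC ideal_actM fmulC.
Qed.

(** * Extension and restriction of characters *)

(** Multiplicativity is [char_ideal_act] at [x = b u]; the functional is nonzero at [u] because
    [phi (u u) = 1]. *)
Lemma carrier_set_ext (R : realType) (A : commFrechetAlgType R)
    (I : closedIdeal A) (phi : carrier_space (ideal_algebra I)) u :
  phi u = 1 -> carrier_set (fun a : A => phi (ideal_act a u)).
Proof.
move=> phiu; have [[philin phic] _ _] := charP phi; split.
- split=> [c a b|a].
    rewrite -philin; congr (phi _); apply: val_inj => /=.
    by rewrite fmulDl fmulZl.
  exact: continuous_comp (@ideal_act_continuous _ _ I u a) (phic _).
- move=> a b; rewrite -(char_ideal_act _ _ phiu); congr (phi _).
  by apply: val_inj => /=; rewrite fmulA.
- exists (ideal_val u); rewrite (_ : ideal_act _ u = fmul u u); last exact: val_inj.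
  by rewrite charM phiu mulr1 oner_neq0.
Qed.

Definition char_ext (R : realType) (A : commFrechetAlgType R)
    (I : closedIdeal A) (phi : carrier_space (ideal_algebra I)) u
    (phiu : phi u = 1) : carrier_space A :=
  mk_char (carrier_set_ext phiu).

Lemma char_extE (R : realType) (A : commFrechetAlgType R)
    (I : closedIdeal A) (phi : carrier_space (ideal_algebra I)) u
    (phiu : phi u = 1) (x : ideal_algebra I) :
  char_ext phiu (ideal_val x) = phi x.
Proof.
rewrite /char_eval /= (_ : ideal_act _ u = fmul x u); last exact: val_inj.
by rewrite -/(char_eval phi _) charM phiu mulr1.
Qed.

Lemma carrier_set_restrict (R : realType) (A : commFrechetAlgType R)
    (I : closedIdeal A) (psi : carrier_space A) (x : ideal_algebra I) :
  psi (ideal_val x) != 0 ->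
  carrier_set (fun y : ideal_algebra I => psi (ideal_val y)).
Proof.
move=> psix; have [[psilin psic] _ _] := charP psi; split.
- split=> [c a b|a]; first by rewrite -psilin.
  exact: continuous_comp (@initial_continuous _ _ _ a) (psic _).
- by move=> a b; rewrite -charM.
- by exists x.
Qed.

(** [None] stands for the characters of [A] that vanish on [I]. *)
Definition char_restrict (R : realType) (A : commFrechetAlgType R)
    (I : closedIdeal A) (psi : carrier_space A) :
    option (carrier_space (ideal_algebra I)) :=
  if pselect (carrier_set (fun y : ideal_algebra I => psi (ideal_val y)))
    is left h
  then Some (mk_char h) else None.

Lemma char_restrictE (R : realType) (A : commFrechetAlgType R)
    (I : closedIdeal A) (psi : carrier_space A) (x : ideal_algebra I) :
  oapp (fun phi : carrier_space _ => phi x) 0 (char_restrict I psi) =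
  psi (ideal_val x).
Proof.
rewrite /char_restrict; case: pselect => //= nrestr.
by have [//|/carrier_set_restrict] := eqVneq (psi (ideal_val x)) 0.
Qed.

(** Hence the extension by zero of [sigma] takes the value [sigma phi] at [char_ext phiu]. *)
Lemma char_extK (R : realType) (A : commFrechetAlgType R)
    (I : closedIdeal A) (phi : carrier_space (ideal_algebra I)) u
    (phiu : phi u = 1) : char_restrict I (char_ext phiu) = Some phi.
Proof.
have phiE : (fun x : ideal_algebra I => char_ext phiu (ideal_val x)) = phi.
  by apply/funext => x; exact: char_extE.
rewrite /char_restrict; case: pselect => [h|]; first by congr Some; exact: val_inj.
by rewrite phiE; have := charP phi.
Qed.

(** * Extension of BSE-functions by zero *)

(** A term at [None] is kept with coefficient [0] at an arbitrary point. The new data do not depend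
    on [f], so they serve both [sigma] and the evaluations at elements of [I]. *)
Lemma sum_oapp (S : pzSemiRingType) (X : Type) n (c : 'I_n -> S)
    (r : 'I_n -> option X) :
  exists m (c' : 'I_m -> S) (x : 'I_m -> X), forall f : X -> S,
    \sum_(i < n) c i * oapp f 0 (r i) = \sum_(j < m) c' j * f (x j).
Proof.
have [[x0]|noX] := pselect (inhabited X).
  exists n, (fun i => if r i is Some _ then c i else 0).
  exists (fun i => odflt x0 (r i)) => f; apply: eq_bigr => i _.
  by case: (r i) => //=; rewrite mulr0 mul0r.
(* With [X] empty, every [r i] is [None] and the sum vanishes. *)
exists 0%N, (fun=> 0), (fun i : 'I_0 => match notF (ltn_ord i) with end) => f.
rewrite big_ord0 big1// => i _; case: (r i) => [x|]; last by rewrite /= mulr0.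
by case: noX.
Qed.

(** Characters vanishing on [I] contribute [0] to both sides of the BSE inequality, so the image of
    [M] in [A] and the same [beta] work. *)
Lemma BSE_function_ext (R : realType) (A : commFrechetAlgType R)
    (I : closedIdeal A) (sigma : carrier_space (ideal_algebra I) -> R[i]^o) :
  discrete_space (carrier_space A) -> BSE_function sigma ->
  BSE_function (fun psi : carrier_space A => oapp sigma 0 (char_restrict I psi)).
Proof.
move=> disc [[K [Kreal sK]] _ [M bM [beta beta0 sM]]]; split.
(* [K] may be negative if [I] has no characters, while the value [0] needs a nonnegative bound. *)
- exists `|K|; split; first exact: normr_real.
  move=> L KL psi _ /=; case: char_restrict => [phi|] /=.
    by apply: sK => //; exact: le_lt_trans (real_ler_norm Kreal) KL.
  by rewrite normr0 ltW// (le_lt_trans _ KL).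
- by apply/continuousP => U _; exact: disc.
- exists (@ideal_val _ _ I @` M).
    by move=> l; have [B MB] := bM l; exists B => _ [x /MB xB <-].
  exists beta => // n c psi.
  have [m [c' [phi sumE]]] := sum_oapp c (fun i => char_restrict I (psi i)).
  rewrite sumE; apply: le_trans (sM _ _ _) _.
  rewrite /sup_on image_comp (_ : [set _ | _ in M] = [set
    modulus (\sum_(i < n) c i * psi i (ideal_val x)) | x in M])//.
  congr image; apply/funext => x; congr modulus.
  have /= <- := sumE (fun phi => phi x).
  by apply: eq_bigr => i _; rewrite char_restrictE.
Qed.

Theorem corollary3p3 (R : realType) (A : commFrechetAlgType R)
    (I : closedIdeal A) :
  BSE_algebra A ->
  schwartz_space A ->
  discrete_space (carrier_space A) ->
  essential_ideal I ->
  has_bounded_Delta_weak_approximate_identity (ideal_algebra I) ->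
  BSE_algebra (ideal_algebra I).
Proof.
move=> AB schwA disc _ /(schwartz_ideal_char_unit schwA)[u u1].
apply/seteqP; split=> sigma.
  move=> [T _ [sigmac sigmaE]].
  have sigmaTu phi : sigma phi = phi (T u) by rewrite sigmaE u1 mulr1.
  (* The values [phi (T u)] are among those of the Gelfand transform of [T u] on [A], through the
     extended characters. *)
  have [[K [Kreal TK]] _ _] := Gelfand_transform_BSE (ideal_val (T u)) AB disc.
  split=> //.
    exists K; split=> // L KL phi _ /=.
    by rewrite sigmaTu -(char_extE (u1 phi)); exact: TK.
  (* With one element and [beta = 1], the BSE inequality is an equality. *)
  exists [set T u]; first by move=> l; exists (fseminorm l (T u)) => _ ->.
  exists 1 => // n c phi; rewrite /sup_on image_set1 sup1 mul1r.
  by under eq_bigr do rewrite sigmaTu.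
move=> sB; have : @C_BSE _ A _ := BSE_function_ext disc sB.
rewrite -AB => -[S _ [_ SE]].
exists (ideal_act (S (ideal_val u))).
  by split; [exact: ideal_act_linear|exact: ideal_actM].
split=> [|x phi]; first by case: sB.
rewrite (char_ideal_act _ _ (u1 phi)); congr (_ * _).
(* The left side unfolds to [phi (ideal_act (S (ideal_val u)) u)]. *)
have := SE (ideal_val u) (char_ext (u1 phi)).
by rewrite char_extE u1 mulr1 char_extK.
Qed.
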